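(* Let $n\ge1$ and $h^\vee=n+\frac12$. For $k\in\mathbb C$, the weight $\lambda=k\Lambda_0$ of the affine Lie superalgebra of $\mathfrak{osp}_{1|2n}$ is admissible if and only if there exist coprime integers $a\in\mathbb Z$ and $b\in\mathbb Z_{\ge1}$ such that $k=\frac ab$ and (1) if $b$ is odd, then $k+h^\vee\ge\dfrac{n+\frac12}{b}$; (2) if $b$ is even, then $k+h^\vee\ge\dfrac{2n-1}{b}$.
   Context: Let $\mathfrak g=\mathfrak{osp}_{1|2n}$ with Cartan subalgebra $\mathfrak h$, root system $\Delta$, and simple roots $\Pi=\{\alpha_1,\dots,\alpha_n\}$, where $\alpha_n$ is the unique odd (non-isotropic) simple root. The highest root is $\theta=2\alpha_1+\dots+2\alpha_n$, and the invariant form is normalized by $(\theta|\theta)=2$, so $(\alpha_i|\alpha_i)=1$, $(\alpha_i|\alpha_{i+1})=-\frac12$ for $1\le i\le n-1$, $(\alpha_n|\alpha_n)=\frac12$, $(\alpha_i|\alpha_j)=0$ for $|i-j|>1$. Let $\widetilde{\mathfrak g}=\mathfrak g[t,t^{-1}]\oplus\mathbb CK\oplus\mathbb CD$ be the untwisted affine Lie superalgebra with $[a t^{m_1},bt^{m_2}]=[a,b]t^{m_1+m_2}+m_1(a|b)\delta_{m_1+m_2,0}K$, $[D,at^m]=m\,at^m$, $K$ central, and $\widetilde{\mathfrak h}=\mathfrak h\oplus\mathbb CK\oplus\mathbb CD$, with the form on $\mathfrak h$ extended by $(K|D)=1$, $(K|K)=(D|D)=(\mathfrak h|K)=(\mathfrak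 h|D)=0$. Let $\widetilde\nu:\widetilde{\mathfrak h}^*\to\widetilde{\mathfrak h}$ be the isomorphism induced by the form, and transport the form to $\widetilde{\mathfrak h}^*$. Let $\delta,\Lambda_0\in\widetilde{\mathfrak h}^*$ satisfy $\delta(D)=\Lambda_0(K)=1$ and vanish on $\mathfrak h$, with $\delta(K)=\Lambda_0(D)=0$. $\widehat\Delta$ is the root system of $\widetilde{\mathfrak g}$, with simple roots $\widehat\Pi=\{\alpha_0=\delta-\theta,\alpha_1,\dots,\alpha_n\}$ and positive roots $\widehat\Delta^+$. For non-isotropic $\alpha$, $\alpha^\vee=2\widetilde\nu(\alpha)/(\alpha|\alpha)$. Let $\rho\in\mathfrak h^*$ be defined by $\rho(\alpha_i^\vee)=1$ for $1\le i\le n$, and $\widehat\rho=\rho+h^\vee\Lambda_0$. The principal roots are $\widehat\Pi_{\mathrm{pr}}=\{\alpha_0,\alpha_1,\dots,\alpha_{n-1},2\alpha_n\}$, and the affine Weyl group $\widehat W\subset GL(\widetilde{\mathfrak h}^* )$ is generated by the reflections $r_\alpha$, $\alpha\in\widehat\Pi_{\mathrm{pr}}$. For $\lambda\in\widetilde{\mathfrak h}^*$ set $$\widehat\Delta(\lambda)=\{\alpha\in\widehat W\widehat\Pi_{\mathrm{pr}}:\lambda(\alpha^\vee)\in\mathbb Z\},\qquad\widehat\Delta(\lambda)^+=\widehat\Delta(\lambda)\cap\widehat\Delta^+,$$ $$\widehat\Pi(\lambda)=\{\beta\in\widehat\Delta(\lambda)^+:\text{there is no }\alpha\in\widehat\Delta(\lambda)\text{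 with }0<r_\alpha(\beta)<\beta\},$$ where $\lambda\ge\mu$ means $\lambda-\mu\in\mathbb Z_{\ge0}(\widehat\Delta\cap\mathbb Q_{\ge0}\widehat\Pi_{\mathrm{pr}})$, i.e. $\lambda-\mu$ is a non-negative integer combination of positive roots. The weight $\lambda$ is called admissible if (i) $(\lambda+\widehat\rho)(\alpha^\vee)>0$ for all $\alpha\in\widehat\Pi(\lambda)$, and (ii) $\mathbb Q\widehat\Delta(\lambda)=\mathbb Q\widehat\Delta$ (equality of $\mathbb Q$-spans). *)

(* Defs.v *)
From HB Require Import structures.
From mathcomp Require Import all_boot all_order all_algebra.
From mathcomp Require Import boolp classical_sets functions cardinality fsbigop reals.
From mathcomp.real_closed Require Import complex.
From mathcomp Require Import ring zify.
Set Implicit Arguments.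
Unset Strict Implicit.
Unset Printing Implicit Defensive.
Import Order.TTheory GRing.Theory Num.Theory.
Local Open Scope classical_set_scope.
Local Open Scope ring_scope.

(* V = C^{1|2n}: the basis vector of index 0 is even, the 2n others are odd. *)
Notation supermx C n := 'M[C]_(1 + (n + n)).

Definition par (n : nat) (i : 'I_(1 + (n + n))) : bool := (0 < i)%N.

Definition hpart (C : numClosedFieldType) (n : nat) (p : bool)
    (X : supermx C n) : supermx C n :=
  \matrix_(i, j) (if (par i (+) par j) == p then X i j else 0).

Definition superbracket (C : numClosedFieldType) (n : nat)
    (X Y : supermx C n) : supermx C n :=
  \sum_(p : bool) \sum_(q : bool)
    (hpart p X *m hpart q Y - (-1) ^+ (p && q) *: (hpart q Y *m hpart p X)).

Definition supertrace (C : numClosedFieldType) (n : nat)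
    (X : supermx C n) : C :=
  \sum_i (-1) ^+ (par i) * X i i.

(* Gram matrix of the form F on V, symmetric on the even part and
   skew-symmetric on the odd part. *)
Definition osp_gram (C : numClosedFieldType) (n : nat) : supermx C n :=
  block_mx 1%:M 0 0 (block_mx 0 1%:M (- 1%:M) 0).

Definition parity_mx (C : numClosedFieldType) (n : nat) (p : bool) :
    supermx C n :=
  \matrix_(i, j) (if i == j then (-1) ^+ (p && par i) else 0).

(* osp(1|2n): each homogeneous component X_p of X satisfies
   F(X_p u, v) + (-1)^(p |u|) F(u, X_p v) = 0 for homogeneous u and all v. *)
Definition osp (C : numClosedFieldType) (n : nat) : set (supermx C n) :=
  [set X | forall p : bool,
     (hpart p X)^T *m osp_gram C n
     + parity_mx C n p *m osp_gram C n *m hpart p X = 0].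

(* The multiple of the supertrace form for which (theta|theta) = 2;
   see theta_norm below. *)
Definition invform (C : numClosedFieldType) (n : nat) (X Y : supermx C n) : C :=
  - supertrace (X *m Y).

(* A triple (f, c, d) stands for sum_m (f m) t^m + c K + d D. *)
Definition loopKD (C : numClosedFieldType) (n : nat) : lmodType C :=
  ((int -> supermx C n) * C^o * C^o)%type.

Definition affine_osp (C : numClosedFieldType) (n : nat) : set (loopKD C n) :=
  [set x | (forall m, osp (x.1.1 m)) /\ finite_set [set m | x.1.1 m != 0]].

Definition affine_bracket (C : numClosedFieldType) (n : nat)
    (x y : loopKD C n) : loopKD C n :=
  (fun m : int =>
     \sum_(i \in [set: int]) superbracket (x.1.1 i) (y.1.1 (m - i))
     + (x.2 * m%:~R) *: y.1.1 m - (y.2 * m%:~R) *: x.1.1 m,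
   \sum_(i \in [set: int]) i%:~R * invform (x.1.1 i) (y.1.1 (- i)),
   0).

(* The affine Cartan subalgebra in coordinates: (h, c, d) stands for
   diag(0, h, -h) + c K + d D, where diag(0, h, -h) runs over the diagonal
   matrices of osp(1|2n). *)
Definition hcar (C : numClosedFieldType) (n : nat) : lmodType C :=
  ('rV[C]_n * C^o * C^o)%type.

Definition diag_osp (C : numClosedFieldType) (n : nat) (h : 'rV[C]_n) :
    supermx C n :=
  diag_mx (row_mx 0 (row_mx h (- h))).

Definition hcar_emb (C : numClosedFieldType) (n : nat) (x : hcar C n) :
    loopKD C n :=
  (fun m : int => if m == 0 then diag_osp x.1.1 else 0, x.1.2, x.2).

Definition hcar_form (C : numClosedFieldType) (n : nat) (x y : hcar C n) : C :=
  invform (diag_osp x.1.1) (diag_osp y.1.1) + x.1.2 * y.2 + x.2 * y.1.2.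

(* The dual of the affine Cartan subalgebra in dual coordinates: (c, l, d)
   stands for sum_i c_i eps_i + l Lambda_0 + d delta, where
   eps_i (diag(0, h, -h)) = h_i. *)
Definition hdual (C : numClosedFieldType) (n : nat) : lmodType C :=
  ('rV[C]_n * C^o * C^o)%type.

Definition pairing (C : numClosedFieldType) (n : nat)
    (l : hdual C n) (x : hcar C n) : C :=
  \sum_i l.1.1 0 i * x.1.1 0 i + l.1.2 * x.1.2 + l.2 * x.2.

(* The isomorphism induced by hcar_form, characterised by nuP below. *)
Definition nu (C : numClosedFieldType) (n : nat) (l : hdual C n) : hcar C n :=
  (2^-1 *: l.1.1, l.2, l.1.2).

Lemma nuP (C : numClosedFieldType) (n : nat) (l : hdual C n) (x : hcar C n) :
  hcar_form (nu l) x = pairing l x.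
Proof.
have dE (d e : 'rV[C]_(1 + (n + n))) i :
    diag_mx (\row_j (d 0 j * e 0 j)) i i = d 0 i * e 0 i.
  by rewrite !mxE eqxx mulr1n.
rewrite /hcar_form /pairing /nu /= addrAC; congr (_ + _ + _).
rewrite /invform /supertrace /diag_osp mulmx_diag.
set d := row_mx _ _; set e := row_mx _ _.
have -> : \sum_i (-1) ^+ par i * diag_mx (\row_j (d 0 j * e 0 j)) i i
    = \sum_i (-1) ^+ par i * (d 0 i * e 0 i).
  by apply: eq_bigr => i _; rewrite dE.
rewrite {}/d {}/e.
rewrite big_split_ord big_ord1 !row_mxEl mxE mul0r mulr0 /= add0r.
rewrite big_split_ord /= -big_split -sumrN; apply: eq_bigr => i _ /=.
rewrite !row_mxEr !row_mxEl !mxE /= !expr1 mulrNN.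
by move: (l.1.1 0 i) (x.1.1 0 i) => a b; field.
Qed.

Definition dual_form (C : numClosedFieldType) (n : nat) (l m : hdual C n) : C :=
  hcar_form (nu l) (nu m).

(* Meant for l with (l|l) <> 0. *)
Definition coroot (C : numClosedFieldType) (n : nat) (l : hdual C n) :
    hcar C n :=
  (2 / dual_form l l) *: nu l.

Definition reflection (C : numClosedFieldType) (n : nat) (a l : hdual C n) :
    hdual C n :=
  l - pairing l (coroot a) *: a.

Definition affine_roots (C : numClosedFieldType) (n : nat) :
    set (hdual C n) :=
  [set a | a != 0 /\
     exists x : loopKD C n, [/\ affine_osp x, x != 0 &
       forall h : hcar C n, affine_bracket (hcar_emb h) x = pairing a h *: x]].

Definition delta (C : numClosedFieldType) (n : nat) : hdual C n := (0, 0, 1).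

Definition Lambda0 (C : numClosedFieldType) (n : nat) : hdual C n := (0, 1, 0).

(* eps_i - eps_(i+1) for i < n - 1, and eps_(n-1) for i = n - 1: indices start
   from 0 here, so this is the simple root numbered i + 1 in the usual
   numbering alpha_1, ..., alpha_n. *)
Definition alpha (C : numClosedFieldType) (n : nat) (i : 'I_n) : hdual C n :=
  (\row_j ((j == i)%:R - (j == i.+1 :> nat)%:R), 0, 0).

Definition theta (C : numClosedFieldType) (n : nat) : hdual C n :=
  \sum_(i < n) 2 *: alpha C i.

Definition alpha0 (C : numClosedFieldType) (n : nat) : hdual C n :=
  delta C n - theta C n.

Definition affine_simple_roots (C : numClosedFieldType) (n : nat) :
    set (hdual C n) :=
  [set a | a = alpha0 C n \/ exists i : 'I_n, a = alpha C i].

Definition principal_roots (C : numClosedFieldType) (n : nat) :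
    set (hdual C n) :=
  [set a | a = alpha0 C n \/
     exists i : 'I_n, a = if i.+1 == n then 2 *: alpha C i else alpha C i].

Definition combinations (C : numClosedFieldType) (V : lmodType C)
    (A : set C) (S : set V) : set V :=
  [set x | exists (m : nat) (c : 'I_m -> C) (v : 'I_m -> V),
     (forall i, A (c i) /\ S (v i)) /\ x = \sum_i c i *: v i].

Definition natural (C : numClosedFieldType) : set C :=
  [set x | exists m : nat, x = m%:R].

Definition rational (C : numClosedFieldType) : set C :=
  [set x | exists q : rat, x = ratr q].

Definition nneg_rational (C : numClosedFieldType) : set C :=
  [set x | exists2 q : rat, 0 <= q & x = ratr q].

Definition integer (C : numClosedFieldType) : set C :=
  [set x | exists z : int, x = z%:~R].

Definition positive_affine_roots (C : numClosedFieldType) (n : nat) :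
    set (hdual C n) :=
  affine_roots (n := n)
  `&` combinations (natural (C := C)) (affine_simple_roots (n := n)).

Definition weight_le (C : numClosedFieldType) (n : nat) (m l : hdual C n) :
    Prop :=
  combinations (natural (C := C))
    (affine_roots (n := n)
     `&` combinations (nneg_rational (C := C)) (principal_roots (n := n)))
    (l - m).

Definition weight_lt (C : numClosedFieldType) (n : nat) (m l : hdual C n) :
    Prop :=
  weight_le m l /\ m <> l.

(* Reflections are involutions, so closing under composition with them gives
   the group that they generate. *)
Inductive affine_weyl (C : numClosedFieldType) (n : nat) :
    (hdual C n -> hdual C n) -> Prop :=
| affine_weyl_id : affine_weyl idfun
| affine_weyl_refl (a : hdual C n) (w : hdual C n -> hdual C n) :
    principal_roots a -> affine_weyl w -> affine_weyl (reflection a \o w).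

Definition weyl_principal_roots (C : numClosedFieldType) (n : nat) :
    set (hdual C n) :=
  [set b | exists (w : hdual C n -> hdual C n) (a : hdual C n),
     [/\ affine_weyl w, principal_roots a & b = w a]].

Definition integral_roots (C : numClosedFieldType) (n : nat) (l : hdual C n) :
    set (hdual C n) :=
  [set a | weyl_principal_roots a /\ integer (pairing l (coroot a))].

Definition positive_integral_roots (C : numClosedFieldType) (n : nat)
    (l : hdual C n) : set (hdual C n) :=
  integral_roots l `&` positive_affine_roots (n := n).

Definition integral_base (C : numClosedFieldType) (n : nat) (l : hdual C n) :
    set (hdual C n) :=
  [set b | positive_integral_roots l b /\
     ~ exists2 a, integral_roots l a &
         weight_lt 0 (reflection a b) /\ weight_lt (reflection a b) b].

(* Characterised by rhoP below. *)
Definition rho (C : numClosedFieldType) (n : nat) : hdual C n :=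
  (\row_(i < n) (n%:R - i%:R - 2^-1), 0, 0).

Definition dual_coxeter (C : numClosedFieldType) (n : nat) : C := n%:R + 2^-1.

Definition rho_hat (C : numClosedFieldType) (n : nat) : hdual C n :=
  rho C n + dual_coxeter C n *: Lambda0 C n.

(* In a numClosedFieldType, 0 < x means that x is real and positive. *)
Definition admissible (C : numClosedFieldType) (n : nat) (l : hdual C n) :
    Prop :=
  (forall a, integral_base l a -> 0 < pairing (l + rho_hat C n) (coroot a)) /\
  combinations (rational (C := C)) (integral_roots l)
    = combinations (rational (C := C)) (affine_roots (n := n)).

Lemma dual_formE (C : numClosedFieldType) (n : nat) (l m : hdual C n) :
  dual_form l m
    = 2^-1 * (\sum_i l.1.1 0 i * m.1.1 0 i) + l.1.2 * m.2 + l.2 * m.1.2.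
Proof.
rewrite /dual_form nuP /pairing /nu /= mulr_sumr; congr (_ + _ + _).
by apply: eq_bigr => i _; rewrite mxE mulrCA.
Qed.

Lemma sum_pairing_alpha (C : numClosedFieldType) (n : nat) (c : 'rV[C]_n)
    (i : 'I_n) :
  \sum_j c 0 j * (alpha C i).1.1 0 j
    = c 0 i - \sum_(j < n | j == i.+1 :> nat) c 0 j.
Proof.
under eq_bigr do rewrite mxE mulrBr !mulr_natr !mulrb.
by rewrite sumrB -!big_mkcond /= big_pred1_eq.
Qed.

Lemma sum_succ (C : numClosedFieldType) (n : nat) (c : nat -> C) (i : 'I_n) :
  \sum_(j < n | j == i.+1 :> nat) c j = if (i.+1 < n)%N then c i.+1 else 0.
Proof.
case: ifPn => [lt_i|]; first by rewrite (big_pred1 (Ordinal lt_i)).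
rewrite -leqNgt => le_n; rewrite big_pred0 // => j.
by rewrite ltn_eqF // (leq_trans (ltn_ord j)).
Qed.

Lemma alpha_gram (C : numClosedFieldType) (n : nat) (i j : 'I_n) :
  dual_form (alpha C i) (alpha C j) =
    if i == j then if i.+1 == n then 2^-1 else 1
    else if (j == i.+1 :> nat) || (i == j.+1 :> nat) then - 2^-1 else 0.
Proof.
rewrite dual_formE /= !mul0r !addr0 sum_pairing_alpha /= mxE.
pose c k : C := (k == i :> nat)%:R - (k == i.+1 :> nat)%:R.
under eq_bigr do rewrite mxE.
rewrite (sum_succ c) /c -!val_eqE /=.
have [ltin ltjn] := (ltn_ord i, ltn_ord j).
case: ltnP => hj; do !case: eqP => ? /=; try (exfalso; lia).
all: by rewrite ?subr0 ?sub0r ?subrr; field.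
Qed.

Lemma rhoP (C : numClosedFieldType) (n : nat) (i : 'I_n) :
  pairing (rho C n) (coroot (alpha C i)) = 1.
Proof.
have -> : pairing (rho C n) (coroot (alpha C i))
    = 2 / dual_form (alpha C i) (alpha C i)
      * dual_form (rho C n) (alpha C i).
  rewrite [dual_form (rho C n) _]/dual_form nuP /coroot /pairing /=.
  rewrite !mul0r !addr0 mulr_sumr; apply: eq_bigr => j _.
  by rewrite [X in _ * X = _]mxE mulrCA.
rewrite alpha_gram eqxx dual_formE /= !mul0r !addr0 sum_pairing_alpha mxE.
under eq_bigr do rewrite mxE.
rewrite (sum_succ (fun k => n%:R - k%:R - 2^-1)) -natr1.
have := ltn_ord i; case: (ltnP i.+1 n) => [lt_in _|le_ni lt_in].
  by rewrite (ltn_eqF lt_in); field.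
have -> : (i.+1 == n) = true by lia.
have -> : n%:R = i%:R + 1 :> C by rewrite natr1; congr _%:R; lia.
by field.
Qed.

Lemma theta_eps (C : numClosedFieldType) (n : nat) :
  theta C n = (\row_j (2 * (j == 0 :> nat)%:R), 0, 0).
Proof.
have eq_hdual (l m : hdual C n) :
    l.1.1 = m.1.1 -> l.1.2 = m.1.2 -> l.2 = m.2 -> l = m.
  by case: l => [[? ?] ?]; case: m => [[? ?] ?] /= -> -> ->.
apply: eq_hdual; rewrite /theta.
- apply/rowP => j; rewrite mxE.
  rewrite (big_morph (fun l : hdual C n => l.1.1 0 j) (id1 := 0) (op1 := +%R)).
  + under eq_bigr do rewrite /= 2!mxE.
    rewrite -mulr_sumr sumrB; congr (_ * _).
    rewrite (bigD1 j) //= eqxx big1 => [|i /negPf ne]; last by rewrite eq_sym ne.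
    case: j => [[|j] lt_j] /=; first by rewrite big1 // addr0 subr0.
    rewrite (bigD1 (Ordinal (ltnW lt_j))) //= eqxx big1 ?subrr // => i.
    by rewrite -val_eqE /= eqSS eq_sym => /negPf ->.
  + by move=> l m; rewrite mxE.
  + by rewrite mxE.
- rewrite (big_morph (fun l : hdual C n => l.1.2) (id1 := 0) (op1 := +%R)) //=.
  by rewrite big1 // => i _; rewrite /= scaler0.
- rewrite (big_morph (fun l : hdual C n => l.2) (id1 := 0) (op1 := +%R)) //=.
  by rewrite big1 // => i _; rewrite /= scaler0.
Qed.

Lemma theta_norm (C : numClosedFieldType) (n : nat) :
  (0 < n)%N -> dual_form (theta C n) (theta C n) = 2.
Proof.
case: n => // n _; rewrite theta_eps dual_formE /= !mul0r !addr0.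
rewrite big_ord_recl big1 => [|i _]; last by rewrite !mxE /= mulr0 mul0r.
by rewrite !mxE /=; field.
Qed.

(* Main.v *)
Require Import Defs.
From HB Require Import structures.
From mathcomp Require Import all_boot all_order all_algebra perm.
From mathcomp Require Import boolp classical_sets functions cardinality fsbigop reals.
From mathcomp.real_closed Require Import complex.
From mathcomp Require Import ring zify.
Set Implicit Arguments.
Unset Strict Implicit.
Unset Printing Implicit Defensive.
Import Order.TTheory GRing.Theory Num.Theory.
Local Open Scope ring_scope.
Local Open Scope complex_scope.

(* The orbit of the principal roots consists of the real roots of C_n^(1), that
   is [± eps_i ± eps_j + m delta] and [± 2 eps_i + m delta]. For k = a/b in
   lowest terms such a root is integral iff b | 2m, resp. b | m; if k is
   irrational then m = 0 for all integral roots, and they do not span delta.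
   Put N = 2b(k + h^vee), an integer of the parity of b. The positivity
   condition at b delta - 2 eps_1 (b odd, or n = 1) reads N > 2n - 1, and at
   (b/2) delta - eps_1 - eps_2 (b even, n >= 2) it reads N > 4n - 4; by parity
   these are the stated bounds. Conversely the bounds give positivity on all
   positive integral roots, so only these two elements of the base have to be
   known. *)

(** * Real roots and their reflections *)

Lemma hdual_eq (C : numClosedFieldType) n (l m : hdual C n) :
  l.1.1 = m.1.1 -> l.1.2 = m.1.2 -> l.2 = m.2 -> l = m.
Proof. by case: l => [[? ?] ?]; case: m => [[? ?] ?] /= -> -> ->. Qed.

(* [± eps_i ± eps_j + m delta]; the case i = j is only meant with s = t, and
   gives the long roots. *)
Definition real_root (C : numClosedFieldType) n (s : bool) (i : 'I_n)
    (t : bool) (j : 'I_n) (m : int) : hdual C n :=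
  ((-1) ^+ s *: delta_mx 0 i + (-1) ^+ t *: delta_mx 0 j, 0, m%:~R).

Lemma sum_delta_mx (C : numClosedFieldType) n (c : 'rV[C]_n) i :
  \sum_k c 0 k * (delta_mx 0 i : 'rV_n) 0 k = c 0 i.
Proof.
rewrite (bigD1 i) //= big1 => [|k /negPf ne]; rewrite mxE eqxx ?eqxx /=.
  by rewrite mulr1 addr0.
by rewrite ne mulr0.
Qed.

Lemma sum_real_root (C : numClosedFieldType) n (c : 'rV[C]_n) s i t j m :
  \sum_k c 0 k * (real_root C s i t j m).1.1 0 k
    = (-1) ^+ s * c 0 i + (-1) ^+ t * c 0 j.
Proof.
under eq_bigr do rewrite !mxE mulrDr !(mulrCA (c 0 _)).
by rewrite big_split -!mulr_sumr; congr (_ * _ + _ * _);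
  rewrite -[RHS]sum_delta_mx; apply: eq_bigr => k _; rewrite mxE.
Qed.

Lemma pairing_coroot (C : numClosedFieldType) n (l a : hdual C n) :
  pairing l (coroot a) = 2 / dual_form a a * dual_form l a.
Proof.
rewrite [dual_form l a]/dual_form nuP /coroot /pairing /= !mulrDr mulr_sumr.
congr (_ + _ + _); rewrite 1?mulrCA //.
by apply: eq_bigr => j _; rewrite [X in _ * X = _]mxE mulrCA.
Qed.

(** Since (eps_i|eps_i) = 1/2, short roots have square length 1 and long ones 2, whence the
    denominator. The hypothesis on signs rules out [eps_i - eps_i + m delta], which is isotropic. *)
Lemma pairing_coroot_real_root (C : numClosedFieldType) n (l : hdual C n)
    s i t j m : (i == j -> s = t) ->
  pairing l (coroot (real_root C s i t j m))
    = ((-1) ^+ s * l.1.1 0 i + (-1) ^+ t * l.1.1 0 j + 2 * l.1.2 * m%:~R)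
      / (i == j).+1%:R.
Proof.
move=> st; rewrite pairing_coroot.
have -> : dual_form (real_root C s i t j m) (real_root C s i t j m)
    = (i == j).+1%:R.
  rewrite dual_formE sum_real_root /= mul0r mulr0 !addr0 !mxE !eqxx /=.
  rewrite (eq_sym j i); move: st; case: eqP => [_ <- //|_ _].
    by case: s; rewrite ?expr1 ?expr0 /=; field.
  by case: s; case: t; rewrite ?expr1 ?expr0 /=; field.
rewrite dual_formE sum_real_root /= mulr0 addr0.
by field; rewrite nat1r pnatr_eq0.
Qed.

Lemma alphaE (C : numClosedFieldType) n (i j : 'I_n) :
  j = i.+1 :> nat -> alpha C i = real_root C false i true j 0.
Proof.
move=> ji; apply: hdual_eq => //=; apply/rowP => k; rewrite !mxE eqxx /=.
have -> : (k == i.+1 :> nat) = (k == j) by rewrite -ji.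
by rewrite expr0 expr1; ring.
Qed.

Lemma alpha_lastE (C : numClosedFieldType) n (i : 'I_n) :
  i.+1 = n -> 2 *: alpha C i = real_root C false i false i 0.
Proof.
move=> iN; apply: hdual_eq => //=; rewrite ?mulr0 ?scaler0 //.
apply/rowP => k; rewrite !mxE eqxx /= iN ltn_eqF //=.
by rewrite expr0; ring.
Qed.

Lemma alpha0E (C : numClosedFieldType) n :
  alpha0 C n.+1 = real_root C true ord0 true ord0 1.
Proof.
rewrite /alpha0 theta_eps; apply: hdual_eq => /=; rewrite ?subr0 //.
apply/rowP => k; rewrite !mxE eqxx /= expr1.
have -> : (k == 0 :> nat) = (k == ord0) by [].
by ring.
Qed.

Lemma reflection_alpha (C : numClosedFieldType) n (i j : 'I_n) (x : hdual C n) :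
  j = i.+1 :> nat ->
  reflection (alpha C i) x = (\row_k x.1.1 0 (tperm i j k), x.1.2, x.2).
Proof.
move=> ji; have ij : (i == j) = false by rewrite -val_eqE /= ji; lia.
rewrite /reflection (alphaE _ ji) pairing_coroot_real_root ?ij //.
rewrite mulr0z mulr0 addr0.
apply: hdual_eq => /=; rewrite ?mulr0z ?scaler0 ?subr0 //.
apply/rowP => k; rewrite !mxE eqxx /= expr0 expr1 divr1.
case: tpermP => [->|->|/eqP/negPf -> /eqP/negPf ->];
  by rewrite ?eqxx ?ij ?(eq_sym j) ?ij /=; ring.
Qed.

Lemma reflection_alpha_last (C : numClosedFieldType) n (i : 'I_n)
    (x : hdual C n) : i.+1 = n ->
  reflection (2 *: alpha C i) x
    = (\row_k ((-1) ^+ (k == i) * x.1.1 0 k), x.1.2, x.2).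
Proof.
move=> iN.
rewrite /reflection (alpha_lastE _ iN) pairing_coroot_real_root //.
rewrite mulr0z mulr0 addr0.
apply: hdual_eq => /=; rewrite ?mulr0z ?scaler0 ?subr0 //.
apply/rowP => k; rewrite !mxE eqxx /= expr0.
by case: eqP => [->|_]; rewrite ?expr0 ?expr1 /=; field.
Qed.

Lemma reflection_alpha0 (C : numClosedFieldType) n (x : hdual C n.+1) :
  x.1.2 = 0 ->
  reflection (alpha0 C n.+1) x
    = (\row_k ((-1) ^+ (k == ord0) * x.1.1 0 k), 0, x.2 + x.1.1 0 ord0).
Proof.
move=> x0.
rewrite /reflection alpha0E pairing_coroot_real_root // x0 mulr0 mul0r addr0.
apply: hdual_eq => /=; rewrite ?x0 ?mulr0 ?scaler0 ?subr0 //.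
  apply/rowP => k; rewrite !mxE eqxx /= expr1.
  by case: eqP => [->|_]; rewrite ?expr0 ?expr1 /=; field.
rewrite expr1; move: (x.1.1 0 ord0) => y.
by change (x.2 - ((-1 * y + -1 * y) / 2) * 1 = x.2 + y); field.
Qed.

(** * The Weyl group orbit of the principal roots *)

Definition is_real_root (C : numClosedFieldType) n (x : hdual C n) : Prop :=
  exists s i t j m, (i == j -> s = t) /\ x = real_root C s i t j m.

Lemma principal_real_root (C : numClosedFieldType) n (a : hdual C n.+1) :
  principal_roots a -> is_real_root a.
Proof.
case=> [->|[i ->]]; first by rewrite alpha0E; exists true, ord0, true, ord0, 1.
case: eqP => [iN|/eqP ne].
  by rewrite alpha_lastE //; exists false, i, false, i, 0.
have lt : (i.+1 < n.+1)%N by have := ltn_ord i; lia.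
rewrite (@alphaE _ _ i (Ordinal lt)) //; exists false, i, true, (Ordinal lt), 0.
by split=> //; rewrite -val_eqE /=; lia.
Qed.

(** On level-zero weights the generators act by adjacent transpositions, by a sign change of the
    last coordinate, and by a sign change of coordinate 0 combined with an integral shift along
    [delta]; each preserves the shape of a real root. *)
Lemma reflection_real_root (C : numClosedFieldType) n (a x : hdual C n.+1) :
  principal_roots a -> is_real_root x -> is_real_root (reflection a x).
Proof.
move=> pa [s [u [t [v [m [uv ->]]]]]].
have flip (i k : 'I_n.+1) :
    (-1) ^+ (k == i) * (real_root C s u t v m).1.1 0 k
    = (real_root C (s (+) (u == i)) u (t (+) (v == i)) v m).1.1 0 k.
  rewrite !mxE eqxx /= !signr_addb mulrDr; congr (_ + _).
    by case: (k =P u) => [->|_]; rewrite ?mulr0 // !mulr1 mulrC.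
  by case: (k =P v) => [->|_]; rewrite ?mulr0 // !mulr1 mulrC.
case: pa => [->|[i ->]].
  rewrite reflection_alpha0 //.
  exists (s (+) (u == ord0)), u, (t (+) (v == ord0)), v.
  (* The amount added to [m] is the coordinate of the root at eps_0. *)
  exists (m + ((-1) ^+ s * (ord0 == u)%:R + (-1) ^+ t * (ord0 == v)%:R)).
  split=> [/eqP e|]; first by rewrite e uv ?e.
  apply: hdual_eq => //=; first by apply/rowP => k; rewrite mxE flip.
  by rewrite !mxE eqxx /= rmorphD rmorphD !rmorphM !rmorph_sign /= !mulrz_nat.
case: eqP => [iN|/eqP ne].
  rewrite reflection_alpha_last //.
  exists (s (+) (u == i)), u, (t (+) (v == i)), v, m.
  split=> [/eqP e|]; first by rewrite e uv ?e.
  by apply: hdual_eq => //=; apply/rowP => k; rewrite mxE flip.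
have lt : (i.+1 < n.+1)%N by have := ltn_ord i; lia.
rewrite (@reflection_alpha _ _ i (Ordinal lt)) //; set p := tperm _ _.
exists s, (p u), t, (p v), m; split=> [|]; first by rewrite (inj_eq perm_inj).
apply: hdual_eq => //=; apply/rowP => k; rewrite !mxE eqxx /=.
by rewrite -!(inj_eq (@perm_inj _ p) (p k)) tpermK.
Qed.

Lemma weyl_principal_real_root (C : numClosedFieldType) n (x : hdual C n.+1) :
  weyl_principal_roots x -> is_real_root x.
Proof.
case=> w [a [ww pa ->{x}]].
elim: ww => [|b {}w pb _ IH /=]; first exact: principal_real_root.
exact: reflection_real_root.
Qed.

Lemma principal_weyl (C : numClosedFieldType) n (a : hdual C n) :
  principal_roots a -> weyl_principal_roots a.
Proof. by move=> pa; exists idfun, a; split=> //; constructor. Qed.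

Lemma reflection_weyl (C : numClosedFieldType) n (a x : hdual C n) :
  principal_roots a -> weyl_principal_roots x ->
  weyl_principal_roots (reflection a x).
Proof.
move=> pa [w [b [ww pb ->]]]; exists (reflection a \o w), b; split=> //.
by constructor.
Qed.

Lemma weyl_tperm (C : numClosedFieldType) n (i j : 'I_n) (x : hdual C n) :
  j = i.+1 :> nat -> weyl_principal_roots x ->
  weyl_principal_roots (\row_k x.1.1 0 (tperm i j k), x.1.2, x.2).
Proof.
move=> ji wx; rewrite -(reflection_alpha _ ji); apply: reflection_weyl => //.
right; exists i; case: eqP => // iN.
by have := ltn_ord j; lia.
Qed.

(** The sign change at the last coordinate is the reflection in [2 alpha_n]; the one at [i] is
    conjugate to the one at [i + 1] by an adjacent transposition, so induction runs downwards from
    the last index. *)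
Lemma weyl_flip (C : numClosedFieldType) n (i : 'I_n) (x : hdual C n) :
  weyl_principal_roots x ->
  weyl_principal_roots (\row_k ((-1) ^+ (k == i) * x.1.1 0 k), x.1.2, x.2).
Proof.
have [d] := ubnP (n - i); elim: d i x => // d IH i x le_d wx.
have [iN|ne] := eqVneq i.+1 n.
  rewrite -reflection_alpha_last //; apply: reflection_weyl => //.
  by right; exists i; rewrite iN eqxx.
have lt : (i.+1 < n)%N by have := ltn_ord i; lia.
have le_d' : (n - (Ordinal lt) < d)%N by move: le_d => /=; lia.
have := weyl_tperm (j := Ordinal lt) erefl wx.
move/(IH _ _ le_d') => /(weyl_tperm (j := Ordinal lt) erefl) /=.
congr (weyl_principal_roots (_, _, _)); apply/rowP => k; rewrite !mxE tpermK.
congr ((-1) ^+ nat_of_bool _ * _).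
by rewrite -(inj_eq (@perm_inj _ (tperm i (Ordinal lt)))) tpermK tpermR.
Qed.

(* Composing r_(alpha_0) with the reflection in eps_0 is a translation. *)
Lemma weyl_translate (C : numClosedFieldType) n (x : hdual C n.+1) :
  x.1.2 = 0 -> weyl_principal_roots x ->
  weyl_principal_roots (x.1.1, 0, x.2 - x.1.1 0 ord0).
Proof.
move=> x0 /(weyl_flip ord0).
rewrite x0 => /(@reflection_weyl _ _ (alpha0 C n.+1)).
rewrite reflection_alpha0 //= => /(_ (or_introl erefl)).
congr (weyl_principal_roots (_, _, _)).
  apply/rowP => k; rewrite !mxE mulrA -signr_addb addbb mul1r //.
by rewrite !mxE eqxx expr1 mulN1r.
Qed.

Lemma weyl_long (C : numClosedFieldType) n (i : 'I_n) :
  weyl_principal_roots (real_root C false i false i 0).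
Proof.
have [d] := ubnP (n - i); elim: d i => // d IH i le_d.
have [iN|ne] := eqVneq i.+1 n.
  rewrite -alpha_lastE //; apply: principal_weyl.
  by right; exists i; rewrite iN eqxx.
have lt : (i.+1 < n)%N by have := ltn_ord i; lia.
have le_d' : (n - (Ordinal lt) < d)%N by move: le_d => /=; lia.
have := weyl_tperm (j := Ordinal lt) erefl (IH _ le_d').
congr weyl_principal_roots; apply: hdual_eq => //=; apply/rowP => k.
rewrite !mxE eqxx /=.
set p := tperm _ _; rewrite -!(inj_eq (@perm_inj _ p) (p k)) tpermK.
by rewrite tpermR.
Qed.

(** The translation raises the [delta]-coefficient of [-2 eps_0 + m delta] by 2, so two starting
    points are needed: the flipped long root for [m = 0] and [alpha_0] for [m = 1]. *)
Lemma weyl_neg_long (C : numClosedFieldType) n (m : nat) :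
  weyl_principal_roots (real_root C true (@ord0 n) true ord0 m%:Z).
Proof.
have [d] := ubnP m; elim: d m => // d IH [|[|m]] lt_d.
- have := weyl_flip ord0 (@weyl_long C n.+1 ord0).
  congr weyl_principal_roots; apply: hdual_eq => //=; apply/rowP => k.
  by rewrite !mxE eqxx /=; case: eqP => _; rewrite ?expr0 ?expr1 /=; ring.
- by rewrite -alpha0E; apply: principal_weyl; left.
have /IH/weyl_translate : (m < d)%N by lia.
move=> /(_ erefl); congr weyl_principal_roots; apply: hdual_eq => //=.
by rewrite !mxE !eqxx /= expr1 -!pmulrn -[m.+2]addn2 natrD; ring.
Qed.

(** Here the translation raises [m] by 1, and [eps_0 - eps_1] with its first sign flipped is the
    starting point. *)
Lemma weyl_neg_short (C : numClosedFieldType) n (m : nat) :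
  weyl_principal_roots
    (real_root C true (@ord0 n.+1) true (lift ord0 ord0) m%:Z).
Proof.
elim: m => [|m IH].
  have /principal_weyl : principal_roots (alpha C (@ord0 n.+1)).
    by right; exists ord0.
  rewrite (@alphaE _ _ _ (lift ord0 ord0)) // => /(weyl_flip ord0).
  congr weyl_principal_roots; apply: hdual_eq => //=; apply/rowP => k.
  rewrite !mxE eqxx /=.
  by case: (k =P ord0) => [->|_]; rewrite ?expr0 ?expr1 /=; ring.
have /(_ erefl) := weyl_translate _ IH.
congr weyl_principal_roots; apply: hdual_eq => //=.
by rewrite !mxE !eqxx /= expr1 -!pmulrn -[m.+1]addn1 natrD; ring.
Qed.

(** * Root vectors *)

(** Diagonal matrices are even, so no sign occurs and the superbracket is the commutator. *)
Lemma superbracket_diag (C : numClosedFieldType) n (h : 'rV[C]_n)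
    (Y : supermx C n) :
  superbracket (diag_osp h) Y = diag_osp h *m Y - Y *m diag_osp h.
Proof.
have h0 : hpart false (diag_osp h) = diag_osp h.
  apply/matrixP => i j; rewrite !mxE.
  by case: (i =P j) => [->|_]; rewrite ?addbb // mulr0n if_same.
have h1 : hpart true (diag_osp h) = 0.
  apply/matrixP => i j; rewrite !mxE.
  by case: (i =P j) => [->|_]; rewrite ?addbb ?mulr0n ?if_same.
have Y01 : Y = hpart true Y + hpart false Y.
  apply/matrixP => i j; rewrite !mxE.
  by case: (par i (+) par j); rewrite /= ?addr0 ?add0r.
rewrite /superbracket !big_bool h0 h1 /= !mul0mx !mulmx0 !scaler0 !subrr.
by rewrite addr0 add0r expr0 !scale1r [in RHS]Y01 mulmxDl mulmxDr opprD addrACA.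
Qed.

Lemma superbracket0 (C : numClosedFieldType) n (Y : supermx C n) :
  superbracket 0 Y = 0.
Proof.
have h0 p : hpart p (0 : supermx C n) = 0.
  by apply/matrixP => i j; rewrite !mxE if_same.
rewrite /superbracket big1 // => p _; rewrite big1 // => q _.
by rewrite h0 mul0mx mulmx0 scaler0 subrr.
Qed.

Lemma affine_bracket_hcar (C : numClosedFieldType) n (h : hcar C n)
    (x : loopKD C n) :
  affine_bracket (hcar_emb h) x
    = (fun m : int => diag_osp h.1.1 *m x.1.1 m - x.1.1 m *m diag_osp h.1.1
                      + (h.2 * m%:~R) *: x.1.1 m, 0, 0).
Proof.
rewrite /affine_bracket /=; congr (_, _, _).
  apply/funext => m.
  rewrite -(@fsbig_widen _ _ _ _ [set 0]%classic) //; last first.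
    by move=> i [_ /= /eqP/negPf ->]; rewrite superbracket0.
  rewrite fsbig_set1 eqxx subr0 superbracket_diag.
  by case: eqP => [->|_]; rewrite ?mulr0 ?scale0r ?scaler0 subr0.
(* The cocycle vanishes: its factor [i] is 0 at mode 0, and the Cartan element has no other mode. *)
rewrite fsbig1 // => i _; case: eqP => [->|_]; first by rewrite mul0r.
rewrite /invform mul0mx /supertrace big1 ?oppr0 ?mulr0 // => j _.
by rewrite mxE mulr0.
Qed.

Lemma diag_mulmx_entry (C : numClosedFieldType) n (h : 'rV[C]_n)
    (Y : supermx C n) u v :
  (diag_osp h *m Y - Y *m diag_osp h) u v
    = (row_mx 0 (row_mx h (- h)) 0 u - row_mx 0 (row_mx h (- h)) 0 v) * Y u v.
Proof. by rewrite /diag_osp mul_diag_mx mul_mx_diag !mxE; ring. Qed.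

Lemma weight_pairing (C : numClosedFieldType) n (u : 'I_(1 + (n + n))) :
  exists c : 'rV[int]_n, forall h : 'rV[C]_n,
    row_mx 0 (row_mx h (- h)) 0 u = \sum_i (c 0 i)%:~R * h 0 i.
Proof.
case: (split_ordP u) => [i ->|j ->].
  exists 0 => h; rewrite row_mxEl mxE big1 // => k _; rewrite mxE mul0r //.
case: (split_ordP j) => i ->.
  exists (delta_mx 0 i) => h; rewrite row_mxEr row_mxEl -[LHS]sum_delta_mx.
  by apply: eq_bigr => k _; rewrite !mxE mulrz_nat mulrC.
exists (- delta_mx 0 i) => h; rewrite !row_mxEr mxE -[h 0 i]sum_delta_mx -sumrN.
by apply: eq_bigr => k _; rewrite !mxE rmorphN /= mulrz_nat mulNr mulrC.
Qed.

Lemma pairing_inj (C : numClosedFieldType) n (a b : hdual C n) :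
  (forall h, pairing a h = pairing b h) -> a = b.
Proof.
move=> ab; have e0 (c : 'rV[C]_n) : \sum_i c 0 i * (0 : 'rV[C]_n) 0 i = 0.
  by rewrite big1 // => i _; rewrite mxE mulr0.
apply: hdual_eq.
- apply/rowP => i; have := ab (delta_mx 0 i, 0, 0).
  by rewrite /pairing /= !mulr0 !addr0 !sum_delta_mx.
- by have := ab (0, 1, 0); rewrite /pairing /= !e0 !mulr0 !mulr1 !addr0 !add0r.
- by have := ab (0, 0, 1); rewrite /pairing /= !e0 !mulr0 !mulr1 !add0r.
Qed.

(** A nonzero matrix entry [(u, v)] in mode [m] of a root vector determines the root: it is
    [m delta] plus the difference of the weights of the basis vectors [u] and [v] of V, which have
    integral coordinates. *)
Lemma affine_root_integral (C : numClosedFieldType) n (a : hdual C n) :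
  affine_roots a ->
  exists (c : 'rV[int]_n) (m : int), a = (map_mx intr c, 0, m%:~R).
Proof.
case=> a0 [x [_ x0 xa]].
have a_pairing : ~ (forall h, pairing a h = 0).
  move=> pa; move/eqP: a0; apply; apply: pairing_inj => h; rewrite pa.
  rewrite /pairing /= !mul0r !addr0 big1 // => i _; rewrite mxE mul0r //.
(* Brackets with the Cartan subalgebra have no [K] or [D] component, so such a component of [x]
   would make [a] vanish identically. *)
have x2 : x.2 = 0.
  apply/eqP; apply: contra_notT a_pairing => xn h.
  have := xa h; rewrite affine_bracket_hcar => /(congr1 snd) /= /esym/eqP.
  by rewrite mulf_eq0 (negPf xn) orbF => /eqP.
have x12 : x.1.2 = 0.
  apply/eqP; apply: contra_notT a_pairing => xn h.
  have := xa h; rewrite affine_bracket_hcar.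
  move=> /(congr1 (fun y : loopKD C n => y.1.2)) /= /esym/eqP.
  by rewrite mulf_eq0 (negPf xn) orbF => /eqP.
have [m xm] : exists m, x.1.1 m != 0.
  apply: contrapT => nx; move/eqP: x0; apply.
  rewrite [x]surjective_pairing x2 [x.1]surjective_pairing x12.
  congr (_, _, _); apply/funext => m; apply/eqP/negPn/negP => xm.
  by apply: nx; exists m.
have [u [v xuv]] : exists u v, x.1.1 m u v != 0.
  apply: contrapT => nx; move/eqP: xm; apply; apply/matrixP => u v.
  rewrite mxE; apply/eqP/negPn/negP => xuv; apply: nx; by exists u, v.
have [cu cuE] := weight_pairing C u; have [cv cvE] := weight_pairing C v.
exists (cu - cv), m; apply: pairing_inj => h; apply: (mulIf xuv).
have := xa h; rewrite affine_bracket_hcar.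
move=> /(congr1 (fun y : loopKD C n => y.1.1 m u v)) /=.
have -> : (pairing a h *: x.1.1) m u v = pairing a h * x.1.1 m u v.
  by rewrite -[RHS]/(_ *: _) -[LHS]/((pairing a h *: x.1.1 m) u v) mxE.
rewrite mxE diag_mulmx_entry cuE cvE [X in _ + X = _]mxE => <-.
rewrite -mulrDl /pairing /= mul0r addr0 -sumrB (mulrC h.2); congr ((_ + _) * _).
by apply: eq_bigr => i _; rewrite !mxE rmorphB mulrBl.
Qed.

Definition sympl (C : numClosedFieldType) n : 'M[C]_(n + n) :=
  block_mx 0 1%:M (- 1%:M) 0.

Lemma tr_sympl (C : numClosedFieldType) n : (sympl C n)^T = - sympl C n.
Proof.
by rewrite /sympl tr_block_mx opp_block_mx !trmx0 linearN /= trmx1 !oppr0 opprK.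
Qed.

Lemma sympl_sqr (C : numClosedFieldType) n : sympl C n *m sympl C n = - 1%:M.
Proof.
rewrite /sympl mulmx_block !mul0mx !mulmx0 !mul1mx mulmx1 !addr0 !add0r.
by rewrite (scalar_mx_block n n) opp_block_mx !oppr0.
Qed.

(* sp(2n) consists of the products of the symplectic matrix with a symmetric
   matrix; its root vectors come from the symmetrised matrix units. *)
Lemma osp_sympl_sym (C : numClosedFieldType) n (S : 'M[C]_(n + n)) :
  S^T = S -> osp (block_mx 0 0 0 (sympl C n *m S) : supermx C n).
Proof.
move=> tS; set X : supermx C n := block_mx _ _ _ _.
have hX p : hpart p X = if p then 0 else X.
  have par_l (i : 'I_1) : par (lshift (n + n) i) = false by rewrite ord1.
  have par_r (i : 'I_(n + n)) : par (rshift 1 i) = true by [].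
  apply/matrixP => i j; rewrite mxE /X.
  have zij : (0 : supermx C n) i j = 0 by rewrite mxE.
  by case: (split_ordP i) zij => i' ->; case: (split_ordP j) => j' -> zij;
    case: p; rewrite ?par_l ?par_r /= ?zij ?block_mxEur ?block_mxEdl ?mxE.
move=> [] /=; rewrite hX; first by rewrite trmx0 mul0mx mulmx0 addr0.
have -> : parity_mx C n false = 1%:M.
  by apply/matrixP => i j; rewrite !mxE; case: eqP.
have -> : osp_gram C n = block_mx 1%:M 0 0 (sympl C n) by [].
rewrite mul1mx /X tr_block_mx !mulmx_block !trmx0.
rewrite !(mul0mx, mulmx0, addr0, add0r).
rewrite trmx_mul tS tr_sympl -mulmxA mulNmx mulmxA sympl_sqr.
rewrite opprK mulmx1 mulNmx mul1mx.
by rewrite add_block_mx !addr0 subrr block_mx0.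
Qed.

(** The diagonal matrix [D] anticommutes with the symplectic matrix [J], so the commutator of [D]
    with [J S] is [-J (D S + S D)]. *)
Lemma ad_diag_sympl (C : numClosedFieldType) n (h : 'rV[C]_n)
    (S : 'M[C]_(n + n)) (c : C) :
  diag_mx (row_mx h (- h)) *m S + S *m diag_mx (row_mx h (- h)) = c *: S ->
  let X : supermx C n := block_mx 0 0 0 (sympl C n *m S) in
  diag_osp h *m X - X *m diag_osp h = - c *: X.
Proof.
move=> DS X; rewrite /diag_osp diag_mx_row /X !mulmx_block.
rewrite !(mul0mx, mulmx0, addr0, add0r) opp_block_mx add_block_mx !subrr.
rewrite scale_block_mx !scaler0; congr block_mx.
set D := diag_mx _ in DS *.
have -> : D *m (sympl C n *m S) = - (sympl C n *m (D *m S)).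
  rewrite !mulmxA -mulNmx; congr (_ *m S).
  rewrite /D diag_mx_row /sympl !mulmx_block opp_block_mx.
  rewrite !(mul0mx, mulmx0, addr0, add0r, mul1mx, mulmx1, mulNmx, mulmxN).
  by rewrite linearN /= !opprK !oppr0.
rewrite -[sympl C n *m S *m D]mulmxA -opprD -mulmxDr DS.
by rewrite scaleNr scalemxAr.
Qed.

(** The root vector is [t^m J S], where [J] is the symplectic matrix and [S] the symmetrised matrix
    unit at the two indices belonging to the signed eps_i and eps_j. *)
Lemma affine_root_real_root (C : numClosedFieldType) n s (i : 'I_n) t j m :
  (i == j -> s = t) -> affine_roots (real_root C s i t j m).
Proof.
move=> st; split.
  apply/eqP => /(congr1 (fun a : hdual C n => a.1.1 0 i)) /eqP; apply/negP.
  rewrite !mxE !eqxx /=; move: st; case: eqP => [_ <-|_ _] //.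
    by rewrite mulr1 -mulr2n mulrn_eq0 signr_eq0.
  by rewrite mulr1 mulr0 addr0 signr_eq0.
(* The halves are swapped, so [ix r l] has weight opposite to the signed eps_l; this compensates the
   minus sign in [ad_diag_sympl]. *)
pose ix (r : bool) (l : 'I_n) := if r then lshift n l else rshift n l.
have ixE r l (h : 'rV[C]_n) : row_mx h (- h) 0 (ix r l) = - ((-1) ^+ r * h 0 l).
  rewrite /ix; case: r; rewrite ?row_mxEl ?row_mxEr ?mxE ?expr0 ?expr1.
    by rewrite mulN1r opprK.
  by rewrite mul1r.
pose S : 'M[C]_(n + n) :=
  delta_mx (ix s i) (ix t j) + delta_mx (ix t j) (ix s i).
pose X : supermx C n := block_mx 0 0 0 (sympl C n *m S).
have tS : S^T = S by rewrite /S linearD /= !trmx_delta addrC.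
have S0 : S != 0.
  apply/eqP => /matrixP/(_ (ix s i) (ix t j))/eqP; rewrite !mxE !eqxx /=.
  by rewrite -natrD pnatr_eq0.
have X0 : X != 0.
  apply: contra S0 => /eqP; rewrite /X -(block_mx0 _ 1 (n + n) 1 (n + n)).
  move=> /eq_block_mx [_ _ _ /(congr1 (mulmx (sympl C n)))].
  by rewrite mulmx0 mulmxA sympl_sqr mulNmx mul1mx => /eqP; rewrite oppr_eq0.
exists (fun p : int => if p == m then X else 0, 0, 0); split.
- split=> [p /=|].
    case: eqP => _; first exact: osp_sympl_sym.
    have := @osp_sympl_sym C n 0; rewrite trmx0 mulmx0 block_mx0; exact.
  apply: (sub_finite_set _ (finite_set1 m)) => p /=.
  by case: (p =P m) => // _; rewrite eqxx.
- apply/eqP => /(congr1 (fun y : loopKD C n => y.1.1 m)) /=.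
  by rewrite eqxx => /eqP; rewrite (negPf X0).
move=> h; rewrite affine_bracket_hcar /=.
have XE : diag_osp h.1.1 *m X - X *m diag_osp h.1.1
    = ((-1) ^+ s * h.1.1 0 i + (-1) ^+ t * h.1.1 0 j) *: X.
  rewrite -[X in X *: _]opprK opprD -!ixE.
  apply: (@ad_diag_sympl C n h.1.1 S).
  move: (row_mx _ _) (ix s i) (ix t j) @S {tS S0 X X0} => d p q S.
  apply/matrixP => a b; rewrite /S mul_diag_mx mul_mx_diag !mxE.
  have e (p' q' : 'I_(n + n)) :
      d 0 a * ((a == p') && (b == q'))%:R
      = d 0 p' * ((a == p') && (b == q'))%:R.
    by case: eqP => [->|] //; rewrite !mulr0.
  have e' (p' q' : 'I_(n + n)) :
      ((a == p') && (b == q'))%:R * d 0 b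
      = d 0 q' * ((a == p') && (b == q'))%:R.
    by rewrite andbC; case: eqP => [->|]; rewrite ?mulr0 ?mul0r // mulrC.
  by rewrite mulrDr mulrDl !e !e'; ring.
have -> : pairing (real_root C s i t j m) h
    = (-1) ^+ s * h.1.1 0 i + (-1) ^+ t * h.1.1 0 j + h.2 * m%:~R.
  rewrite /pairing -(@sum_real_root C n h.1.1 s i t j m) /= mul0r addr0 mulrC.
  by congr (_ + _); apply: eq_bigr => k _; rewrite mulrC.
congr (_, _, _); rewrite /= ?scaler0 //.
apply/funext => p; rewrite -[RHS]/(_ *: (if p == m then X else 0)).
case: eqP => [->|_]; last by rewrite mulmx0 mul0mx !scaler0 subrr addr0.
by rewrite XE -scalerDl.
Qed.

(** * Spans and positivity *)

Lemma sum_hdual (C : numClosedFieldType) n m (f : 'I_m -> hdual C n) :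
  \sum_i f i = (\sum_i (f i).1.1, \sum_i (f i).1.2, \sum_i (f i).2).
Proof.
apply: hdual_eq => /=.
- exact: (big_morph (fun x : hdual C n => x.1.1)).
- exact: (big_morph (fun x : hdual C n => x.1.2)).
- exact: (big_morph (fun x : hdual C n => x.2)).
Qed.

(** Serves both sides of the span condition, with [M = 1] for all roots and [M = b] for the integral
    ones. The long roots give every eps_i, and [M delta - 2 eps_0] then gives [delta]. *)
Lemma rational_combinations (C : numClosedFieldType) n (S : set (hdual C n.+1))
    (M : nat) : (0 < M)%N ->
  (forall x, S x ->
     exists (c : 'rV[int]_n.+1) (m : int), x = (map_mx intr c, 0, m%:~R)) ->
  (forall i, S (real_root C false i false i 0)) ->
  S (real_root C true ord0 true ord0 M) ->
  combinations (@Defs.rational C) S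
    = [set x | exists (c : 'rV[rat]_n.+1) (q : rat),
                 x = (map_mx ratr c, 0, ratr q)]%classic.
Proof.
move=> M_gt0 SZ Slong SM; apply/seteqP; split=> x /=.
  move=> [m [c [v [cv ->]]]].
  elim/big_ind: _ => [|_ _ [c1 [q1 ->]] [c2 [q2 ->]]|i _].
  - exists 0, 0; rewrite rmorph0; apply: hdual_eq => //=.
    by apply/rowP => k; rewrite !mxE rmorph0.
  - exists (c1 + c2), (q1 + q2); rewrite rmorphD; apply: hdual_eq => //=.
      by apply/rowP => k; rewrite !mxE rmorphD.
    by rewrite addr0.
  have [[q ->] /SZ [d [l ->]]] := cv i.
  exists (q *: map_mx intr d), (q * l%:~R).
  rewrite rmorphM /= ratr_int; apply: hdual_eq => //=; last by rewrite scaler0.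
  by apply/rowP => k; rewrite !mxE rmorphM /= ratr_int.
move=> [c [q ->]].
(* Index 0 carries [M delta - 2 eps_0] with coefficient [q / M]; the others carry the [2 eps_i],
   with an extra [q / M] at [i = 0] to cancel [-2 eps_0]. *)
pose a (k : 'I_n.+2) : rat := if unlift ord0 k is Some i
  then c 0 i / 2 + (i == ord0)%:R * (q / M%:R) else q / M%:R.
pose v (k : 'I_n.+2) := if unlift ord0 k is Some i
  then real_root C false i false i 0 else real_root C true ord0 true ord0 M.
have M0 : M%:R != 0 :> C by rewrite pnatr_eq0 -lt0n.
exists n.+2, (fun k => ratr (a k)), v; split=> [k|].
  by split; [exists (a k)|rewrite /v; case: unliftP => [i _|_]].
have v2 i : v (lift ord0 i) = real_root C false i false i 0 by rewrite /v liftK.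
have a2 i : ratr (a (lift ord0 i)) = ratr (c 0 i) / 2
    + (i == ord0)%:R * (ratr q / M%:R) :> C.
  by rewrite /a liftK rmorphD rmorphM fmorphV rmorphM fmorph_div /= !ratr_nat.
have v1 : v ord0 = real_root C true ord0 true ord0 M by rewrite /v unlift_none.
have a1 : ratr (a ord0) = ratr q / M%:R :> C.
  by rewrite /a unlift_none fmorph_div /= ratr_nat.
rewrite big_ord_recl v1 a1.
under eq_bigr do rewrite v2 a2.
rewrite sum_hdual; apply: hdual_eq => /=.
- apply/rowP => k; rewrite !mxE summxE.
  rewrite (bigD1 k) //= big1 => [|i ik]; rewrite !mxE eqxx.
    by rewrite eqxx /= expr0 expr1 addr0; field.
  by rewrite (eq_sym k) (negPf ik) /= !mulr0 addr0 mulr0.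
- by rewrite big1 ?scaler0 ?addr0 // => i _; rewrite scaler0.
rewrite big1 => [|i _]; last exact: mulr0.
by rewrite addr0 -pmulrn -[RHS]/(_ * _); field.
Qed.

(** This is [2 (rho|x)]: it takes the value 1 on [alpha_1, ..., alpha_(n-1)] but 1/2 on the odd
    simple root. *)
Definition height (C : numClosedFieldType) n (x : hdual C n) : C :=
  \sum_i (rho C n).1.1 0 i * x.1.1 0 i.

Lemma height_is_linear (C : numClosedFieldType) n (c : C) (x y : hdual C n) :
  height (c *: x + y) = c * height x + height y.
Proof.
rewrite /height mulr_sumr -big_split; apply: eq_bigr => i _ /=.
by rewrite !mxE; ring.
Qed.

Lemma height0 (C : numClosedFieldType) n : height (0 : hdual C n) = 0.
Proof. by rewrite /height big1 // => i _; rewrite [X in _ * X]mxE mulr0. Qed.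

(** A numerical consequence of positivity, both for roots and for differences in the weight order;
    it replaces the analysis of combinations of simple roots. *)
Definition lex_pos (C : numClosedFieldType) n (x : hdual C n) : Prop :=
  0 < x.2 \/ x.2 = 0 /\ 0 < height x.

Lemma lex_pos_combinations (C : numClosedFieldType) n (A : set C)
    (S : set (hdual C n)) (x : hdual C n) :
  (forall c, A c -> 0 <= c) -> (forall y, S y -> y = 0 \/ lex_pos y) ->
  combinations A S x -> x = 0 \/ lex_pos x.
Proof.
move=> A_ge0 S_pos [m [c [v [cv ->]]]].
elim/big_ind: _ => [|y z [->|y_pos] [->|z_pos]|i _]; first by left.
- by left; rewrite addr0.
- by right; rewrite add0r.
- by right; rewrite addr0.
- right; have hD : height (y + z) = height y + height z.
    by rewrite -[y]scale1r height_is_linear mul1r scale1r.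
  case: y_pos => [y2|[y2 hy]]; case: z_pos => [z2|[z2 hz]].
  + by left; apply: addr_gt0.
  + by left; rewrite /= z2 addr0.
  + by left; rewrite /= y2 add0r.
  + by right; rewrite hD /= y2 z2 addr0; split=> //; apply: addr_gt0.
have [/A_ge0 c_ge0 /S_pos [->|v_pos]] := cv i; first by left; rewrite scaler0.
move: c_ge0; rewrite le_eqVlt => /predU1P[<-|c_gt0].
  by left; rewrite scale0r.
have hZ : height (c i *: v i) = c i * height (v i).
  by rewrite -[c i *: v i]addr0 height_is_linear height0 addr0.
right; case: v_pos => [v2|[v2 hv]]; first by left; apply: mulr_gt0.
by right; rewrite hZ; split; [rewrite /= v2; apply: mulr0|apply: mulr_gt0].
Qed.

Lemma height_alpha (C : numClosedFieldType) n (i : 'I_n) :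
  0 < height (alpha C i).
Proof.
rewrite /height sum_pairing_alpha !mxE.
under eq_bigr do rewrite mxE.
rewrite (sum_succ (fun k => n%:R - k%:R - 2^-1)).
case: ifPn => [_|/negP ne].
  have -> : n%:R - i%:R - 2^-1 - (n%:R - i.+1%:R - 2^-1) = 1 :> C.
    by rewrite -[i.+1]addn1 natrD; ring.
  exact: ltr01.
have -> : n%:R = i%:R + 1 :> C.
  by rewrite natr1; congr _%:R; have := ltn_ord i; lia.
have -> : i%:R + 1 - i%:R - 2^-1 - 0 = 2^-1 :> C by field.
by rewrite invr_gt0 ltr0n.
Qed.

Lemma lex_pos_simple (C : numClosedFieldType) n (x : hdual C n) :
  affine_simple_roots x -> lex_pos x.
Proof.
case=> [->|[i ->]]; last by right; split=> //; apply: height_alpha.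
left; rewrite /alpha0 theta_eps /= subr0; exact: ltr01.
Qed.

Lemma lex_pos_principal (C : numClosedFieldType) n (x : hdual C n) :
  principal_roots x -> lex_pos x.
Proof.
case=> [->|[i ->]]; first by apply: lex_pos_simple; left.
right; have h := height_alpha C i; case: eqP => _; split=> //=.
  exact: mulr0.
rewrite -[2 *: _]addr0 height_is_linear height0 addr0.
by rewrite mulr_gt0 // ltr0n.
Qed.

Lemma lex_pos_positive_root (C : numClosedFieldType) n (x : hdual C n) :
  positive_affine_roots x -> lex_pos x.
Proof.
case=> [[/eqP x0 _]] /lex_pos_combinations [c [m ->]|y /lex_pos_simple|//|//].
  exact: ler0n.
by right.
Qed.

Lemma lex_pos_weight_lt (C : numClosedFieldType) n (x y : hdual C n) :
  weight_lt x y -> lex_pos (y - x).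
Proof.
move=> [xy ne].
(* The order is built in two layers, natural combinations of roots that are nonnegative rational
   combinations of principal roots; positivity passes through both. *)
have [c [m ->]|z [_ z_comb]|yx|//] := lex_pos_combinations _ _ xy.
- exact: ler0n.
- apply: lex_pos_combinations z_comb => [c [q q0 ->]|t /lex_pos_principal].
    by rewrite ler0q.
  by right.
by case: ne; apply/esym/eqP; rewrite -subr_eq0 yx.
Qed.

(** * Positivity of the roots to be tested *)

Lemma combinationsD (C : numClosedFieldType) (V : lmodType C) (A : set C)
    (S : set V) (x y : V) :
  combinations A S x -> combinations A S y -> combinations A S (x + y).
Proof.
move=> [m1 [c1 [v1 [cv1 ->]]]] [m2 [c2 [v2 [cv2 ->]]]].
exists (m1 + m2)%N.
exists (fun i => match fintype.split i with inl j => c1 j | inr j => c2 j end).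
exists (fun i => match fintype.split i with inl j => v1 j | inr j => v2 j end).
split=> [i|]; first by case: fintype.split.
rewrite big_split_ord; congr (_ + _); apply: eq_bigr => i _.
  by rewrite -[lshift _ _]/(unsplit (inl i)) unsplitK.
by rewrite -[rshift _ _]/(unsplit (inr i)) unsplitK.
Qed.

Lemma simple_combination (C : numClosedFieldType) n (x : hdual C n) :
  affine_simple_roots x ->
  combinations (@natural C) (affine_simple_roots (n := n)) x.
Proof.
move=> sx; exists 1, (fun _ => 1), (fun _ => x); split=> [_|].
  by split=> //; exists 1.
by rewrite big_ord1 scale1r.
Qed.

Lemma combinationD_delta (C : numClosedFieldType) n (x : hdual C n) (m : nat) :
  combinations (@natural C) (affine_simple_roots (n := n)) x ->
  combinations (@natural C) (affine_simple_roots (n := n))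
    (x + m%:R *: delta C n).
Proof.
move=> cx; elim: m => [|m IH]; first by rewrite scale0r addr0.
(* Each further [delta] is [alpha_0 + theta], a sum of simple roots. *)
have -> : x + m.+1%:R *: delta C n
    = (x + m%:R *: delta C n) + (alpha0 C n + theta C n).
  by rewrite /alpha0 subrK -natr1 scalerDl scale1r addrA.
apply: combinationsD IH _; apply: combinationsD.
  by apply: simple_combination; left.
exists n, (fun _ => 2), (fun i => alpha C i); split=> // i.
by split; [exists 2|right; exists i].
Qed.

Lemma positive_neg_long (C : numClosedFieldType) n (m : nat) : (0 < m)%N ->
  positive_affine_roots (real_root C true (@ord0 n) true ord0 m).
Proof.
case: m => // m _; split; first exact: affine_root_real_root.
have : affine_simple_roots (alpha0 C n.+1) by left.
move=> /simple_combination /(combinationD_delta m).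
congr (combinations _ _ _); rewrite alpha0E; apply: hdual_eq => /=.
- by rewrite scaler0 addr0.
- by rewrite add0r; apply: mulr0.
by rewrite -[m.+1]add1n PoszD rmorphD; congr (_ + _); apply: mulr1.
Qed.

Lemma positive_neg_short (C : numClosedFieldType) n (m : nat) : (0 < m)%N ->
  positive_affine_roots
    (real_root C true (@ord0 n.+1) true (lift ord0 ord0) m).
Proof.
case: m => // m _; split; first exact: affine_root_real_root.
have a0 : affine_simple_roots (alpha0 C n.+2) by left.
have a1 : affine_simple_roots (alpha C (@ord0 n.+1)) by right; exists ord0.
have := combinationsD (simple_combination a0) (simple_combination a1).
move=> /(combinationD_delta m).
congr (combinations _ _ _); rewrite alpha0E (@alphaE _ _ _ (lift ord0 ord0)) //.
apply: hdual_eq => /=.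
- by apply/rowP => k; rewrite !mxE /= expr0 expr1; ring.
- by rewrite !add0r; apply: mulr0.
by rewrite -[m.+1]add1n PoszD rmorphD addr0; congr (_ + _); apply: mulr1.
Qed.

(** * The base of the integral roots *)

(** Doubled coordinates of [rho], integral so that the inequalities can be settled over [int]. *)
Definition rho2 n (i : 'I_n) : int := 2 * n%:Z - 2 * i%:Z - 1.

Lemma rho2E (C : numClosedFieldType) n (i : 'I_n) :
  (rho C n).1.1 0 i = (rho2 i)%:~R / 2.
Proof. by rewrite mxE /rho2 !intrB !intrM -!pmulrn; field. Qed.

Lemma height_real_root (C : numClosedFieldType) n s (i : 'I_n) t j m :
  height (real_root C s i t j m)
    = ((-1) ^+ s * rho2 i + (-1) ^+ t * rho2 j)%:~R / 2.
Proof.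
rewrite /height sum_real_root !rho2E; move: (rho2 i) (rho2 j) => a b.
rewrite intrD !intrM !rmorph_sign /=.
by rewrite mulrDl !mulrA.
Qed.

Lemma lex_pos_int (C : numClosedFieldType) n (x : hdual C n) (z h : int) :
  x.2 = z%:~R -> height x = h%:~R / 2 ->
  lex_pos x <-> (0 < z \/ z = 0 /\ 0 < h).
Proof.
rewrite /lex_pos => -> ->; rewrite ltr0z pmulr_lgt0 ?invr_gt0 ?ltr0n // ltr0z.
split=> [[|[/eqP]]|[|[->]]]; rewrite ?intr_eq0; try by [left|right].
by move=> /eqP ? ?; right.
Qed.

Lemma weyl_integral (C : numClosedFieldType) n (x : hdual C n.+1) :
  weyl_principal_roots x ->
  exists (c : 'rV[int]_n.+1) (m : int), x = (map_mx intr c, 0, m%:~R).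
Proof.
move=> /weyl_principal_real_root [s [i [t [j [m [_ ->]]]]]].
exists ((-1) ^+ s *: delta_mx 0 i + (-1) ^+ t *: delta_mx 0 j), m.
apply: hdual_eq => //=; apply/rowP => k.
by rewrite !mxE intrD !intrM !rmorph_sign /= !mulrz_nat.
Qed.

(* If the reflection of beta = M delta - eps_1 - eps_j in an integral root a is
   positive and below beta, then beta is the sum of r_a(beta) and c a, and M
   divides their delta-coefficients: one of them is 0, the other is M. If that
   of a is 0, dominance of eps_1 + eps_j is violated; otherwise the maximality
   of its height is. *)
Lemma integral_base_neg (C : numClosedFieldType) n (l : hdual C n.+1)
    (j : 'I_n.+1) (M : nat) :
  (j <= 1)%N -> (0 < M)%N ->
  (forall s u t v m, (u == v -> s = t) ->
     integral_roots l (real_root C s u t v m) -> (M%:Z %| m)%Z) ->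
  (forall s u t v m, (u == v -> s = t) ->
     integral_roots l (real_root C s u t v m) ->
     `|m|%N = M -> j != ord0 -> u != v) ->
  integral_roots l (real_root C true ord0 true j M) ->
  positive_affine_roots (real_root C true ord0 true j M) ->
  integral_base l (real_root C true ord0 true j M).
Proof.
move=> j1 M_gt0 dvdM shortM intM posM; split=> // -[a inta [r_pos r_lt]].
have [s [u [t [v [m [uv aE]]]]]] := weyl_principal_real_root inta.1.
rewrite {a}aE in inta r_pos r_lt.
have /dvdzP [q mE] := dvdM _ _ _ _ _ uv inta.
(* [d k] is the coefficient of eps_k in eps_0 + eps_j; below, [c] is the pairing of beta with the
   coroot of [a], so that beta minus its reflection is [c a]. *)
pose d k : int := (k == ord0)%:R + (k == j)%:R.
have [c cE cd] : exists2 c : int,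
    pairing (real_root C true ord0 true j M) (coroot (real_root C s u t v m))
    = c%:~R & c * (u == v).+1 = - ((-1) ^+ s * d u + (-1) ^+ t * d v).
  exists (if u == v then - ((-1) ^+ s * d u)
          else - ((-1) ^+ s * d u + (-1) ^+ t * d v)).
    rewrite pairing_coroot_real_root // !mxE !eqxx /= expr1 mulr0 mul0r addr0.
    rewrite /d; move: uv; case: (u =P v) => [<- <- //|_ _].
      rewrite !(mulrNz, intrD, intrM) !rmorph_sign !mulrz_nat.
      by rewrite /=; field.
    rewrite !(mulrNz, intrD, intrM) !rmorph_sign !mulrz_nat.
    by rewrite /=; field.
  by move: uv; case: (u =P v) => [<- <- //|_ _] /=; ring.
have hr0 : height (reflection (real_root C s u t v m)
      (real_root C true ord0 true j M))
    = (- (rho2 (@ord0 n) + rho2 j)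
       - c * ((-1) ^+ s * rho2 u + (-1) ^+ t * rho2 v))%:~R / 2.
  rewrite /reflection cE -scaleNr addrC height_is_linear !height_real_root.
  move: (rho2 ord0) (rho2 j) (rho2 u) (rho2 v) => r0 rj ru rv.
  by rewrite !(intrD, mulrNz, intrM) !rmorph_sign /= ?expr1; field.
have hr1 : height (real_root C true ord0 true j M
      - reflection (real_root C s u t v m) (real_root C true ord0 true j M))
    = (c * ((-1) ^+ s * rho2 u + (-1) ^+ t * rho2 v))%:~R / 2.
  rewrite -scaleN1r addrC height_is_linear hr0 height_real_root.
  move: (rho2 ord0) (rho2 j) (rho2 u) (rho2 v) => r0 rj ru rv.
  by rewrite !(intrD, mulrNz, intrM) !rmorph_sign /= ?expr1; field.
have r2 : (reflection (real_root C s u t v m)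
    (real_root C true ord0 true j M)).2 = (M%:Z - c * m)%:~R.
  by rewrite /reflection cE intrB intrM.
move/lex_pos_weight_lt: r_pos; rewrite subr0 => /(lex_pos_int r2 hr0) r_pos.
have r2' : (real_root C true ord0 true j M - reflection (real_root C s u t v m)
    (real_root C true ord0 true j M)).2 = (c * m)%:~R.
  by rewrite -[LHS]/(M%:~R - (reflection _ _).2) r2 -intrB; congr _%:~R; ring.
move/lex_pos_weight_lt/(lex_pos_int r2' hr1): r_lt => {hr0 hr1 r2 r2'} r_lt.
have ltu := ltn_ord u; have ltv := ltn_ord v; have ltj := ltn_ord j.
have M1 : 0 < M%:Z by [].
(* The [delta]-coefficients [c m] of [c a] and [M - c m] of the reflected root are nonnegative, and
   [c m = (c q) M]. *)
have cq01 : c * q = 0 \/ c * q = 1.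
  have cm : c * m = c * q * M%:Z by rewrite mE mulrA.
  have [cq_le0|cq_gt0] : c * q <= 0 \/ 1 <= c * q by lia.
    by left; apply/eqP; rewrite eq_le cq_le0 /= -(pmulr_lge0 _ M1) -cm; lia.
  by right; apply/eqP; rewrite eq_le cq_gt0 andbT -(ler_pM2r M1) -cm; lia.
have o0 : nat_of_ord (@ord0 n) = 0%N by [].
rewrite /rho2 o0 in r_pos r_lt.
case: cq01 => [cq0|cq1].
  have m0 : c * m = 0 by rewrite mE mulrA cq0 mul0r.
  have {r_lt r_pos} r_lt : 0 < c * ((-1) ^+ s * rho2 u + (-1) ^+ t * rho2 v).
    by rewrite /rho2; lia.
  (* Eliminating [c] by [cd] shows that [a] pairs with eps_0 + eps_j and with [rho] in opposite
     signs. As [j <= 1], eps_0 + eps_j is dominant, which excludes this. *)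
  have : 0 < (- ((-1) ^+ s * d u + (-1) ^+ t * d v))
             * ((-1) ^+ s * rho2 u + (-1) ^+ t * rho2 v).
    by rewrite -cd mulrAC pmulr_lgt0.
  rewrite /d /rho2 -!val_eqE /=.
  move: uv {inta cE cd r_lt}; rewrite -val_eqE /=.
  case: s; case: t; rewrite ?expr0 ?expr1 => uv;
    do !case: eqP => ? /=; try lia; nia.
(* Now the reflected root has [delta]-coefficient 0 and needs positive height, so the finite part of
   [-c a] would be higher than eps_0 + eps_j. That is the maximum among all roots if [j = 0], and
   among short ones if [j = 1]; [shortM] makes [a] short in the latter case. *)
have [[c1 q1]|[c1 q1]] : (c = 1 /\ q = 1) \/ (c = -1 /\ q = -1).
  have /eqP := congr1 absz cq1.
  rewrite abszM muln_eq1 => /andP[/eqP cA /eqP qA].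
  have [c1|c1] : c = 1 \/ c = -1 by lia.
    by left; split=> //; move: cq1; rewrite c1 mul1r.
  by right; split=> //; move: cq1; rewrite c1 mulN1r => <-; rewrite opprK.
  rewrite {}q1 in mE; rewrite {}c1 in r_pos; have mM : `|m|%N = M by lia.
  have := shortM _ _ _ _ _ uv inta mM; rewrite -!val_eqE /=.
  by case: s r_pos {inta uv cE cd r_lt}; case: t;
    rewrite ?expr0 ?expr1 => r_pos uv'; lia.
rewrite {}q1 in mE; rewrite {}c1 in r_pos; have mM : `|m|%N = M by lia.
have := shortM _ _ _ _ _ uv inta mM; rewrite -!val_eqE /=.
by case: s r_pos {inta uv cE cd r_lt}; case: t;
  rewrite ?expr0 ?expr1 => r_pos uv'; lia.
Qed.

(** * The level bound *)

Lemma pairing_Lambda0 (C : numClosedFieldType) n (k : C) s (i : 'I_n) t j m :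
  (i == j -> s = t) ->
  pairing (k *: Lambda0 C n) (coroot (real_root C s i t j m))
    = 2 * k * m%:~R / (i == j).+1%:R.
Proof.
move=> st; rewrite pairing_coroot_real_root // !mxE !mulr0 !add0r.
by congr (2 * _ * _ / _); apply: mulr1.
Qed.

Section RationalLevel.

Variables (C : numClosedFieldType) (n : nat) (A : int) (b : nat).
Hypotheses (b_gt0 : (0 < b)%N) (cop : coprimez A b%:Z).

Let k : C := A%:~R / b%:R.
Let N : int := 2 * A + b%:Z * (2 * n%:Z + 1).

Let b0 : b%:R != 0 :> C.
Proof. by rewrite pnatr_eq0 -lt0n. Qed.

(** At a long root the pairing is [k m = A m / b], and [A] is prime to [b]; at a short root it is
    [2 k m]. *)
Lemma integral_long_dvd s (i : 'I_n) t m :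
  integral_roots (k *: Lambda0 C n) (real_root C s i t i m) -> s = t ->
  (b%:Z %| m)%Z.
Proof.
move=> [_ [z]] + st; rewrite pairing_Lambda0 ?eqxx // => e.
have {e} : A * m = z * b%:Z.
  apply/eqP; rewrite -(eqr_int C) !intrM -e -pmulrn /k; apply/eqP => /=; field.
  by rewrite b0.
move=> e; rewrite -(@Gauss_dvdzr _ A) ?[coprimez _ A]coprimez_sym //.
by rewrite e dvdz_mull.
Qed.

Lemma integral_short_dvd s (i : 'I_n) t j m : i != j ->
  integral_roots (k *: Lambda0 C n) (real_root C s i t j m) ->
  (b%:Z %| 2 * m)%Z.
Proof.
move=> ij [_ [z]]; rewrite pairing_Lambda0 ?(negPf ij) // => e.
have {e} : A * (2 * m) = z * b%:Z.
  apply/eqP; rewrite -(eqr_int C) !intrM -e -pmulrn /k; apply/eqP => /=; field.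
  by rewrite b0.
move=> e; rewrite -(@Gauss_dvdzr _ A) ?[coprimez _ A]coprimez_sym //.
by rewrite e dvdz_mull.
Qed.

Lemma level_shiftE : k + dual_coxeter C n = N%:~R / (2 * b%:R).
Proof.
rewrite /k /N /dual_coxeter !(intrD, intrM) -!pmulrn; field.
by rewrite b0.
Qed.

(** The pairing is multiplied by [2 b], and by a further 2 at long roots, to become an integer. *)
Lemma pairing_shift_gt0 s (i : 'I_n) t j m : (i == j -> s = t) ->
  (0 < pairing (k *: Lambda0 C n + rho_hat C n)
         (coroot (real_root C s i t j m)))
  = (0 < b%:Z * ((-1) ^+ s * rho2 i + (-1) ^+ t * rho2 j) + 2 * N * m).
Proof.
move=> st; rewrite pairing_coroot_real_root //.
have -> : (k *: Lambda0 C n + rho_hat C n).1.2 = N%:~R / (2 * b%:R).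
  rewrite -level_shiftE /= add0r; congr (_ + _); exact: mulr1.
have rE l : (k *: Lambda0 C n + rho_hat C n).1.1 0 l = (rho2 l)%:~R / 2.
  by rewrite -rho2E !mxE /= !mulr0 add0r addr0.
rewrite !rE; move: (rho2 i) (rho2 j) N => ri rj N'.
rewrite -[RHS](ltr0z C).
rewrite -[RHS](pmulr_lgt0 _ (_ : 0 < (2 * b%:R * (i == j).+1%:R)^-1)).
  congr (0 < _); rewrite !(intrD, intrM) !rmorph_sign -!pmulrn; field.
  by rewrite b0 nat1r pnatr_eq0.
by rewrite invr_gt0 !mulr_gt0 ?ltr0n.
Qed.

Lemma odd_boundE : (n%:R + 2^-1) / b%:R <= k + dual_coxeter C n
  = (2 * n%:Z + 1 <= N).
Proof.
rewrite level_shiftE -(ler_int C).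
rewrite -[RHS](ler_pM2r (_ : 0 < (2 * b%:R)^-1)); last first.
  by rewrite invr_gt0 mulr_gt0 ?ltr0n.
congr (_ <= _); rewrite !(intrD, intrM) -!pmulrn; field.
by rewrite b0.
Qed.

Lemma even_boundE : (2 * n%:R - 1) / b%:R <= k + dual_coxeter C n
  = (4 * n%:Z - 2 <= N).
Proof.
rewrite level_shiftE -(ler_int C).
rewrite -[RHS](ler_pM2r (_ : 0 < (2 * b%:R)^-1)); last first.
  by rewrite invr_gt0 mulr_gt0 ?ltr0n.
congr (_ <= _); rewrite !(intrB, intrM) -!pmulrn; field.
by rewrite b0.
Qed.

End RationalLevel.

(** * Necessity and sufficiency of the bound *)

Lemma integral_neg_long (C : numClosedFieldType) n (A : int) (b : nat) :
  (0 < b)%N ->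
  integral_roots (A%:~R / b%:R *: Lambda0 C n.+1)
    (real_root C true ord0 true ord0 b).
Proof.
move=> b_gt0; have b0 : b%:R != 0 :> C by rewrite pnatr_eq0 -lt0n.
split; first exact: weyl_neg_long.
by exists A; rewrite pairing_Lambda0 // -pmulrn /=; field.
Qed.

Lemma admissible_level_bound (C : numClosedFieldType) n (A : int) (b : nat) :
  (0 < b)%N -> coprimez A b%:Z ->
  admissible (A%:~R / b%:R *: Lambda0 C n.+1) ->
  let N := 2 * A + b%:Z * (2 * n.+1%:Z + 1) in
  (odd b -> 2 * n.+1%:Z + 1 <= N) /\ (~~ odd b -> 4 * n.+1%:Z - 2 <= N).
Proof.
move=> b_gt0 cop [pos _] N; set l := _ *: _ in pos.
have o0 : nat_of_ord (@ord0 n) = 0%N by [].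
have dvd_m s u t v m : (u == v -> s = t) ->
    odd b || (n == 0)%N || (u == v) ->
    integral_roots l (real_root C s u t v m) -> (b%:Z %| m)%Z.
  move=> uv; have [e|ne] := eqVneq u v => ob int_r.
    have st := uv (introT eqP e); rewrite -e in int_r.
    exact: integral_long_dvd int_r st.
  have := integral_short_dvd b_gt0 cop ne int_r.
  rewrite orbF in ob; case/orP: ob => [ob|/eqP n0].
    by rewrite Gauss_dvdzr // coprimezE /= coprimen2.
  by move: ne; rewrite -val_eqE /=; have := ltn_ord u; have := ltn_ord v; lia.
have long_base : odd b || (n == 0)%N ->
    0 < b%:Z * (- (2 * n.+1%:Z - 1) *+ 2) + 2 * N * b%:Z.
  move=> ob; have /pos : integral_base l (real_root C true ord0 true ord0 b).
    apply: integral_base_neg => //.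
    - by move=> s u t v m uv; apply: dvd_m; rewrite ?ob.
    - exact: integral_neg_long.
    - exact: positive_neg_long.
  rewrite (@pairing_shift_gt0 C _ A b b_gt0) // -/N /rho2 o0 expr1; lia.
split=> [ob|nob].
  have := long_base; rewrite ob => /(_ isT).
  (* With [b] odd, [N] is odd, so the strict bound by the odd number [2 n + 1] (the rank being
     [n + 1]) improves by 2. *)
  have : exists N' : int, N = 2 * N' + 1.
    by exists ((N - 1) %/ 2)%Z; rewrite /N; lia.
  by move=> [N' ->]; nia.
have [b' bE] : exists b', b = b'.*2 by exists b./2; lia.
have b'_gt0 : (0 < b')%N by lia.
have [N' NE] : exists N' : int, N = 2 * N'.
  by exists (A + b'%:Z * (2 * n.+1%:Z + 1)); rewrite /N bE; lia.
(* In rank one the long root is tested for even [b] too, giving [N > 1], hence [N >= 2] by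
   parity. *)
case: n @N @l pos o0 dvd_m long_base NE => [|n'] N l pos o0 dvd_m long_base NE.
  have := long_base; rewrite orbT => /(_ isT); rewrite NE; nia.
have b'0 : b'%:R != 0 :> C by rewrite pnatr_eq0 -lt0n.
have /pos : integral_base l (real_root C true ord0 true (lift ord0 ord0) b').
  apply: integral_base_neg => //.
  - move=> s u t v m uv int_r.
    have [e|ne] := eqVneq u v.
      have := dvd_m _ _ _ _ _ uv _ int_r; rewrite e eqxx orbT => /(_ isT).
      by move=> /dvdzP [q ->]; rewrite bE; apply/dvdzP; exists (q * 2); lia.
    have := integral_short_dvd b_gt0 cop ne int_r.
    by move=> /dvdzP [q e]; apply/dvdzP; exists q; move: e; rewrite bE; lia.
  (* A long integral root has [b | m], which [|m| = b / 2] contradicts. *)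
  - move=> s u t v m uv int_r mb' _; apply/eqP => e.
    have := dvd_m _ _ _ _ _ uv _ int_r; rewrite e eqxx orbT => /(_ isT).
    by rewrite dvdzE mb' /= => /(dvdn_leq b'_gt0); lia.
  - split; first exact: weyl_neg_short.
    (* The pairing at this short root is [2 k b' = k b = A]. *)
    exists A; rewrite pairing_Lambda0 // -pmulrn bE -muln2 natrM /=; field.
    by rewrite b'0.
  exact: positive_neg_short.
rewrite (@pairing_shift_gt0 C _ A b b_gt0) // -/N /rho2 o0 expr1 NE bE.
have -> : nat_of_ord (lift (@ord0 n'.+1) ord0) = 1%N by [].
nia.
Qed.

(** By the span condition [delta - 2 eps_0] is a combination of integral roots, so one of these has
    [m] nonzero; integrality of its pairing, [2 k m] or [k m], makes [k] rational. *)
Lemma admissible_rational (C : numClosedFieldType) n (k : C) :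
  admissible (k *: Lambda0 C n.+1) ->
  exists (A : int) (b : nat),
    [/\ (0 < b)%N, coprimez A b%:Z & k = A%:~R / b%:R].
Proof.
move=> [_ span_eq].
have : combinations (@Defs.rational C) (affine_roots (n := n.+1))
    (real_root C true ord0 true ord0 1).
  exists 1, (fun _ => 1), (fun _ => real_root C true ord0 true ord0 1).
  rewrite big_ord1 scale1r; split=> // _.
  by split; [exists 1; rewrite rmorph1|apply: affine_root_real_root].
rewrite -span_eq => -[p [c [v [cv e]]]].
have [i vi] : exists i, (v i).2 <> 0.
  apply: contrapT => nv; have /eqP := congr1 (fun x : hdual C n.+1 => x.2) e.
  rewrite sum_hdual /= big1 => [|i _]; first by rewrite oner_eq0.
  have -> : (v i).2 = 0 by apply: contrapT => ?; apply: nv; exists i.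
  exact: mulr0.
have [_ [wv [z]]] := cv i.
have [s [u [t [w [m [uw vE]]]]]] := weyl_principal_real_root wv.
rewrite {}vE /= in vi *; rewrite pairing_Lambda0 // => kz.
have m0 : m%:~R != 0 :> C by apply/eqP.
have kE : k = ratr (z%:~R * (u == w).+1%:R / (2 * m%:~R)).
  rewrite fmorph_div !rmorphM /= !ratr_int !ratr_nat -kz; field.
  by rewrite m0 nat1r pnatr_eq0.
move: (_ / _) kE => q ->.
have dE : denq q = `|denq q|%N :> int by rewrite gez0_abs ?denq_ge0.
exists (numq q), `|denq q|%N; split; first by rewrite absz_gt0 denq_neq0.
  by rewrite -dE coprimezE coprime_num_den.
by rewrite -[q in LHS]divq_num_den fmorph_div /= !ratr_int [in LHS]dE -pmulrn.
Qed.

Lemma level_bound_admissible (C : numClosedFieldType) n (A : int) (b : nat) :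
  let N := 2 * A + b%:Z * (2 * n.+1%:Z + 1) in
  (0 < b)%N -> coprimez A b%:Z ->
  (odd b -> 2 * n.+1%:Z + 1 <= N) -> (~~ odd b -> 4 * n.+1%:Z - 2 <= N) ->
  admissible (A%:~R / b%:R *: Lambda0 C n.+1).
Proof.
move=> N b_gt0 cop N_odd N_even; split; last first.
  rewrite (@rational_combinations C n _ b) //.
  - apply/esym; apply: (@rational_combinations C n _ 1) => //.
    + by move=> x /affine_root_integral.
    + by move=> i; apply: affine_root_real_root.
    exact: affine_root_real_root.
  - by move=> x [/weyl_integral].
  - move=> i; split; first exact: weyl_long.
    by exists 0; rewrite pairing_Lambda0 // mulr0 mul0r.
  exact: integral_neg_long.
move=> a [[int_a pos_a] _].
have [s [u [t [v [m [uv aE]]]]]] := weyl_principal_real_root int_a.1.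
rewrite {a}aE in int_a pos_a *.
rewrite (@pairing_shift_gt0 C _ A b b_gt0) // -/N.
have a2 : (real_root C s u t v m).2 = m%:~R by [].
have /(lex_pos_int a2 (height_real_root _ _ _ _ _ _)) :=
  lex_pos_positive_root pos_a.
have bZ : 0 < b%:Z by [].
(* For [m = 0] the level drops out and positivity of the height is the claim. *)
case=> {pos_a a2} [m_gt0|[-> h_gt0]]; last by rewrite mulr0 addr0 mulr_gt0.
have ltu := ltn_ord u; have ltv := ltn_ord v.
have [e|ne] := eqVneq u v.
  have st := uv (introT eqP e); rewrite -e -st in int_a *.
  have /dvdzP [q mE] := integral_long_dvd b_gt0 cop int_a erefl.
  have q_gt0 : 0 < q by move: m_gt0; rewrite mE pmulr_lgt0.
  have -> : b%:Z * ((-1) ^+ s * rho2 u + (-1) ^+ s * rho2 u) + 2 * N * m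
      = b%:Z * 2 * ((-1) ^+ s * rho2 u + N * q) by rewrite mE; ring.
  rewrite pmulr_rgt0 ?mulr_gt0 //.
  (* Long roots need only [N > 2r - 1] for the rank [r], which follows from either bound as
     [4r - 2 >= 2r]. *)
  have N_big : 2 * n.+1%:Z <= N.
    case ob: (odd b) in N_odd N_even; first by have := N_odd isT; lia.
    by have := N_even isT; lia.
  have Nq : N <= N * q by nia.
  by rewrite /rho2; case: s {int_a uv st}; rewrite ?expr0 ?expr1; lia.
have /dvdzP [q mE] := integral_short_dvd b_gt0 cop ne int_a.
have q_gt0 : 0 < q by rewrite -(pmulr_lgt0 _ bZ) -mE; lia.
move: ne {uv int_a}; rewrite -val_eqE /= => ne.
case ob: (odd b) in N_odd N_even.
  (* For odd [b], [2m = q b] forces [q] even; the resulting factor 2 on [N] suffices, as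
     [2 (2r + 1)] exceeds [4r - 4], the largest doubled height of a short root. *)
  have [q' qE] : exists q', q = 2 * q'.
    have : (2 %| q * b%:Z)%Z by rewrite -mE dvdz_mulr.
    rewrite mulrC Gauss_dvdzr ?coprimezE /= ?coprime2n // => /dvdzP [q' ->].
    by exists q'; rewrite mulrC.
  have {}mE : m = q' * b%:Z by move: mE; rewrite qE; lia.
  have -> : b%:Z * ((-1) ^+ s * rho2 u + (-1) ^+ t * rho2 v) + 2 * N * m
      = b%:Z * (((-1) ^+ s * rho2 u + (-1) ^+ t * rho2 v) + 2 * (N * q')).
    by rewrite mE; ring.
  rewrite pmulr_rgt0 //.
  have N_big := N_odd isT; have Nq : N <= N * q' by nia.
  by rewrite /rho2; case: s; case: t; rewrite ?expr0 ?expr1; lia.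
(* For even [b], [q] may be odd, so [N] itself must exceed [4r - 4]. *)
have -> : b%:Z * ((-1) ^+ s * rho2 u + (-1) ^+ t * rho2 v) + 2 * N * m
    = b%:Z * (((-1) ^+ s * rho2 u + (-1) ^+ t * rho2 v) + N * q).
  by rewrite mulrAC mE; ring.
rewrite pmulr_rgt0 //.
have N_big := N_even isT; have Nq : N <= N * q by nia.
by rewrite /rho2; case: s; case: t; rewrite ?expr0 ?expr1; lia.
Qed.

Theorem propositionA1 (R : realType) (n : nat) (n_gt0 : (0 < n)%N) (k : R[i]) :
  admissible (k *: Lambda0 R[i] n) <->
  exists (a : int) (b : nat),
    [/\ (0 < b)%N, coprimez a b%:Z, k = a%:~R / b%:R,
        (odd b -> (n%:R + 2^-1) / b%:R <= k + dual_coxeter R[i] n) &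
        (~~ odd b -> (2 * n%:R - 1) / b%:R <= k + dual_coxeter R[i] n)].
Proof.
case: n n_gt0 => // n _; split=> [adm|[a [b [b_gt0 cop -> odd_b even_b]]]].
  have [a [b [b_gt0 cop kE]]] := admissible_rational adm.
  rewrite {}kE in adm *; exists a, b.
  have [odd_b even_b] := admissible_level_bound b_gt0 cop adm.
  split=> // ob; first by rewrite odd_boundE //; apply: odd_b.
  by rewrite even_boundE //; apply: even_b.
apply: level_bound_admissible => // ob.
  by rewrite -(@odd_boundE R[i]) //; apply: odd_b.
by rewrite -(@even_boundE R[i]) //; apply: even_b.
Qed.
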